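(* Every De Morgan clone $\mathsf C$ with $\mathsf{DMA}\subsetneq\mathsf C$ contains at least one of the functions $\mathrm{mnh}^2_1$, $\mathrm{mnh}^2_2$, $\mathrm{mhnp}^3$. Moreover, the three clones $\langle\mathsf{DMA},\mathrm{mhnp}^3\rangle$, $\langle\mathsf{DMA},\mathrm{mnh}^2_1\rangle$, $\langle\mathsf{DMA},\mathrm{mnh}^2_2\rangle$ are pairwise incomparable by inclusion.
   Context: Let $\mathrm{DM}_4=\{\mathsf t,\mathsf f,\mathsf n,\mathsf b\}$. The truth order $\le$ has $\mathsf f$ least, $\mathsf t$ greatest, $\mathsf n,\mathsf b$ incomparable; $\wedge,\vee$ are its meet and join. De Morgan negation: $-\mathsf t=\mathsf f$, $-\mathsf f=\mathsf t$, $-\mathsf n=\mathsf n$, $-\mathsf b=\mathsf b$. A De Morgan function is a map $\mathrm{DM}_4^n\to\mathrm{DM}_4$, $n\ge1$; a De Morgan clone is a set of such functions closed under composition and containing all projections; constants are unary constant functions. $\mathsf{DMA}$ is the clone generated by $\wedge,\vee,\mathsf t,\mathsf f,-$, and $\langle\mathsf{DMA},g\rangle$ is the clone generated by $\mathsf{DMA}\cup\{g\}$. The binary functions $\mathrm{mnh}^2_1,\mathrm{mnh}^2_2$ are given, listing for each first argument $x$ the values at $y=\mathsf t,\mathsf f,\mathsf n,\mathsf b$: $\mathrm{mnh}^2_1$: $x=\mathsf t,\mathsf f,\mathsf b$: $\mathsf f,\mathsf f,\mathsf n,\mathsf b$; $x=\mathsf n$: $\mathsf f,\mathsf f,\mathsf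 n,\mathsf f$. $\mathrm{mnh}^2_2$: $x=\mathsf t,\mathsf f,\mathsf n$: $\mathsf f,\mathsf f,\mathsf n,\mathsf b$; $x=\mathsf b$: $\mathsf f,\mathsf f,\mathsf f,\mathsf b$. The ternary function $\mathrm{mhnp}^3(x,y,z)$ is defined by: $\mathrm{mhnp}^3(x,\mathsf t,z)=\mathrm{mhnp}^3(x,\mathsf f,z)=\mathsf f$ for all $x,z$; $\mathrm{mhnp}^3(\mathsf t,\mathsf n,z)=\mathsf n$ for all $z$; $\mathrm{mhnp}^3(x,\mathsf n,z)=\mathsf f$ for $x\in\{\mathsf f,\mathsf b\}$ and all $z$; $\mathrm{mhnp}^3(\mathsf n,\mathsf n,z)=\mathsf n$ for $z\in\{\mathsf t,\mathsf n,\mathsf f\}$ and $\mathrm{mhnp}^3(\mathsf n,\mathsf n,\mathsf b)=\mathsf f$; and, listing for each $x$ the values of $\mathrm{mhnp}^3(x,\mathsf b,z)$ at $z=\mathsf t,\mathsf f,\mathsf n,\mathsf b$: $x=\mathsf t$: $\mathsf b,\mathsf b,\mathsf b,\mathsf b$; $x=\mathsf f$: $\mathsf f,\mathsf f,\mathsf f,\mathsf f$; $x=\mathsf n$: $\mathsf f,\mathsf f,\mathsf f,\mathsf f$; $x=\mathsf b$: $\mathsf b,\mathsf b,\mathsf f,\mathsf b$. *)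

(* Defs.v *)
From HB Require Import structures.
From mathcomp Require Import all_boot all_order.

Set Implicit Arguments.
Unset Strict Implicit.
Unset Printing Implicit Defensive.

Inductive DM4 : Type := dmT | dmF | dmN | dmB.

Definition DM4_code (x : DM4) : bool * bool :=
  match x with
  | dmT => (true, false)
  | dmF => (false, true)
  | dmN => (false, false)
  | dmB => (true, true)
  end.

Definition DM4_decode (c : bool * bool) : DM4 :=
  match c with
  | (true, false) => dmT
  | (false, true) => dmF
  | (false, false) => dmN
  | (true, true) => dmB
  end.

Lemma DM4_codeK : cancel DM4_code DM4_decode.
Proof. by case. Qed.

HB.instance Definition _ := Finite.copy DM4 (can_type DM4_codeK).

Definition dm_le (x y : DM4) : bool := [|| x == dmF, y == dmT | x == y].
Definition dm_lt (x y : DM4) : bool := (y != x) && dm_le x y.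

Definition dm_meet (x y : DM4) : DM4 :=
  match x, y with
  | dmT, z | z, dmT => z
  | dmN, dmN => dmN
  | dmB, dmB => dmB
  | _, _ => dmF
  end.

Definition dm_join (x y : DM4) : DM4 :=
  match x, y with
  | dmF, z | z, dmF => z
  | dmN, dmN => dmN
  | dmB, dmB => dmB
  | _, _ => dmT
  end.

Fact dm_display : Order.disp_t. Proof. exact: Order.Disp tt tt. Qed.

Fact dm_ltE x y : dm_lt x y = (y != x) && dm_le x y. Proof. by []. Qed.
Fact dm_leE x y : dm_le x y = (dm_meet x y == x). Proof. by case: x y => [] []. Qed.
Fact dm_meetC : commutative dm_meet. Proof. by case=> [] []. Qed.
Fact dm_joinC : commutative dm_join. Proof. by case=> [] []. Qed.
Fact dm_meetA : associative dm_meet. Proof. by case=> [] [] []. Qed.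
Fact dm_joinA : associative dm_join. Proof. by case=> [] [] []. Qed.
Fact dm_joinKI y x : dm_meet x (dm_join x y) = x. Proof. by case: x y => [] []. Qed.
Fact dm_meetKU y x : dm_join x (dm_meet x y) = x. Proof. by case: x y => [] []. Qed.
Fact dm_meetUl : left_distributive dm_meet dm_join. Proof. by case=> [] [] []. Qed.
Fact dm_meetxx : idempotent_op dm_meet. Proof. by case. Qed.

HB.instance Definition _ :=
  Order.isMeetJoinDistrLattice.Build dm_display DM4 dm_leE dm_ltE
    dm_meetC dm_joinC dm_meetA dm_joinA dm_joinKI dm_meetKU dm_meetUl dm_meetxx.

Fact dm_le0x x : (dmF <= x :> DM4)%O. Proof. by case: x. Qed.
Fact dm_lex1 x : (x <= dmT :> DM4)%O. Proof. by case: x. Qed.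

HB.instance Definition _ := Order.hasBottom.Build dm_display DM4 dm_le0x.
HB.instance Definition _ := Order.hasTop.Build dm_display DM4 dm_lex1.

Definition dm_neg (x : DM4) : DM4 :=
  match x with dmT => dmF | dmF => dmT | dmN => dmN | dmB => dmB end.

Definition dmfun (n : nat) : Type := {ffun n.-tuple DM4 -> DM4}.

Definition dmfun1 (h : DM4 -> DM4) : dmfun 1 :=
  [ffun v : 1.-tuple DM4 => h [tnth v 0]].
Definition dmfun2 (h : DM4 -> DM4 -> DM4) : dmfun 2 :=
  [ffun v : 2.-tuple DM4 => h [tnth v 0] [tnth v 1]].
Definition dmfun3 (h : DM4 -> DM4 -> DM4 -> DM4) : dmfun 3 :=
  [ffun v : 3.-tuple DM4 => h [tnth v 0] [tnth v 1] [tnth v 2]].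

Definition dmproj (n : nat) (i : 'I_n) : dmfun n :=
  [ffun v : n.-tuple DM4 => tnth v i].

Definition dmcomp (n m : nat) (f : dmfun n) (g : 'I_n -> dmfun m) : dmfun m :=
  [ffun v : m.-tuple DM4 => f [tuple g i v | i < n]].

Definition dmset : Type := forall n : nat, dmfun n -> Prop.

Definition dmsubset (A B : dmset) : Prop :=
  forall (n : nat) (f : dmfun n), A n f -> B n f.

Definition dmproper (A B : dmset) : Prop := dmsubset A B /\ ~ dmsubset B A.

Definition dmincomparable (A B : dmset) : Prop :=
  ~ dmsubset A B /\ ~ dmsubset B A.

Definition dmsetU (A B : dmset) : dmset := fun n f => A n f \/ B n f.

Inductive dmset1 (k : nat) (g : dmfun k) : dmset :=
  | Dmset1 : dmset1 g g.

(* [dmfun 0] is inhabited, but De Morgan functions have arity at least 1;     *)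
(* [dmclone_arity] excludes nullary functions from clones.                    *)
Record dmclone (C : dmset) : Prop := DMClone {
  dmclone_arity : forall (n : nat) (f : dmfun n), C n f -> 0 < n;
  dmclone_proj : forall (n : nat) (i : 'I_n), C n (dmproj i);
  dmclone_comp : forall (n m : nat) (f : dmfun n) (g : 'I_n -> dmfun m),
    C n f -> (forall i : 'I_n, C m (g i)) -> C m (dmcomp f g)
}.

Definition dmgenerated (G : dmset) : dmset := fun n f =>
  forall C : dmset, dmclone C -> dmsubset G C -> C n f.

Inductive DMA_gen : dmset :=
  | DMA_meet : DMA_gen (dmfun2 (fun x y => (x `&` y)%O))
  | DMA_join : DMA_gen (dmfun2 (fun x y => (x `|` y)%O))
  | DMA_true : DMA_gen (dmfun1 (fun=> dmT))
  | DMA_false : DMA_gen (dmfun1 (fun=> dmF))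
  | DMA_neg : DMA_gen (dmfun1 dm_neg).

Definition DMA : dmset := dmgenerated DMA_gen.

Definition DMA_adjoin (k : nat) (g : dmfun k) : dmset :=
  dmgenerated (dmsetU DMA (dmset1 g)).

Definition mnh21 : dmfun 2 := dmfun2 (fun x y =>
  match x, y with
  | _, dmT => dmF
  | _, dmF => dmF
  | _, dmN => dmN
  | dmN, dmB => dmF
  | _, dmB => dmB
  end).

Definition mnh22 : dmfun 2 := dmfun2 (fun x y =>
  match x, y with
  | _, dmT => dmF
  | _, dmF => dmF
  | dmB, dmN => dmF
  | _, dmN => dmN
  | _, dmB => dmB
  end).

Definition mhnp3 : dmfun 3 := dmfun3 (fun x y z =>
  match x, y, z with
  | _, dmT, _ => dmF
  | _, dmF, _ => dmF
  | dmT, dmN, _ => dmN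
  | dmF, dmN, _ => dmF
  | dmB, dmN, _ => dmF
  | dmN, dmN, dmB => dmF
  | dmN, dmN, _ => dmN
  | dmT, dmB, _ => dmB
  | dmF, dmB, _ => dmF
  | dmN, dmB, _ => dmF
  | dmB, dmB, dmN => dmF
  | dmB, dmB, _ => dmB
  end).

(* Main.v *)
(* Write d for conflation (exchanging n and b) and [= for the information     *)
(* order (n least, b greatest, t and f incomparable). The n-ary part of a     *)
(* clone C over DMA is a bounded sublattice of a power of {0, 1}, hence is    *)
(* cut out by implications between coordinates; pairing each implication with *)
(* the one obtained by negation, any g outside C violates at some inputs u, v *)
(* one of the relations x [= y, x [= d y, d x [= y, although all of C         *)
(* satisfies it at u, v. For mnh21 this leaves only d f(b,n) [= f(n,b), for   *)
(* mnh22 only f(b,n) [= d f(n,b), so if C contains neither then C commutes    *)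
(* with d. If C also omits mhnp3, then f(n,n,b) [= f(t,n,b) on C. As (b,n),   *)
(* (n,b) generate the graph of d under DMA, and (n,t), (n,n), (b,b) generate  *)
(* [=, C then preserves both relations, and so does not exceed DMA by the     *)
(* same criterion. The clones are separated by the relations [= and d and by  *)
(* x [= d y and d x [= y.                                                     *)
Require Import Defs.
From mathcomp Require Import all_boot all_order.
From mathcomp Require Import boolp.

Set Implicit Arguments.
Unset Strict Implicit.
Unset Printing Implicit Defensive.

Definition dm_conf (x : DM4) : DM4 :=
  match x with dmT => dmT | dmF => dmF | dmN => dmB | dmB => dmN end.

Definition dm_info (x y : DM4) : bool := [|| x == dmN, y == dmB | x == y].

Lemma dm_confK : involutive dm_conf.
Proof. by case. Qed.

Lemma dm_info_conf x y : dm_info (dm_conf x) (dm_conf y) = dm_info y x.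
Proof. by case: x y => [] []. Qed.

(** Conflation reverses [dm_info], so the first hypothesis becomes [dm_info y (dm_conf x)], and
    antisymmetry concludes. *)
Lemma dm_conf_infoP x y :
  dm_info x (dm_conf y) -> dm_info (dm_conf x) y -> dm_conf x = y.
Proof. by case: x y => [] []. Qed.

(* The two prime filters of DM4: {t, b} for [true] and {t, n} for [false]. *)
Definition dm_filter (p : bool) (x : DM4) : bool :=
  if p then (DM4_code x).1 else ~~ (DM4_code x).2.

Lemma dm_filterI p x y :
  dm_filter p (x `&` y)%O = dm_filter p x && dm_filter p y.
Proof. by case: p x y => [] [] []. Qed.

Lemma dm_filterU p x y :
  dm_filter p (x `|` y)%O = dm_filter p x || dm_filter p y.
Proof. by case: p x y => [] [] []. Qed.

Lemma dm_filter0 p : dm_filter p dmF = false.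
Proof. by case: p. Qed.

Lemma dm_filter1 p : dm_filter p dmT.
Proof. by case: p. Qed.

Lemma dm_filterN p x : dm_filter p (dm_neg x) = ~~ dm_filter (~~ p) x.
Proof. by case: p x => [] []. Qed.

Lemma dm_filter_inj x y : (forall p, dm_filter p x = dm_filter p y) -> x = y.
Proof. by move=> e; move: (e true) (e false); case: x y {e} => [] []. Qed.

Lemma dm_filter_conf p x : dm_filter p (dm_conf x) = dm_filter (~~ p) x.
Proof. by case: p x => [] []. Qed.

(** The information order is componentwise on [DM4_code]; [dm_filter false] negates the second
    component, hence the reversed implication. *)
Lemma dm_infoP x y :
  reflect ((dm_filter true x -> dm_filter true y) /\
           (dm_filter false y -> dm_filter false x)) (dm_info x y).
Proof.
suff -> : dm_info x y = (dm_filter true x ==> dm_filter true y) &&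
                        (dm_filter false y ==> dm_filter false x).
  by apply: (iffP andP) => -[/implyP ? /implyP].
by case: x y => [] [].
Qed.

Lemma tuple2P T (u : 2.-tuple T) : exists a b, u = [tuple a; b].
Proof.
case/tupleP: u => a u; case/tupleP: u => b u; rewrite (tuple0 u).
by exists a, b; apply: val_inj.
Qed.

Lemma tuple3P T (u : 3.-tuple T) : exists a b c, u = [tuple a; b; c].
Proof.
case/tupleP: u => a u; have [b [c ->]] := tuple2P u.
by exists a, b, c; apply: val_inj.
Qed.

Definition dm_conf_rel (x y : DM4) : bool := dm_conf x == y.

Definition dmpreserves (R : DM4 -> DM4 -> bool) n (f : dmfun n) : Prop :=
  forall u v, (forall i, R (tnth u i) (tnth v i)) -> R (f u) (f v).

(** * Interpolation in clones over [DMA] *)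

Section CloneOverDMA.

Variable C : dmset.
Hypotheses (cloneC : dmclone C) (DMAC : dmsubset DMA C).

Lemma DMA_gen_sub : dmsubset DMA_gen C.
Proof. by move=> n f genf; apply: DMAC => D _; apply. Qed.

Lemma clone_op1 (h : DM4 -> DM4) n (f : dmfun n) :
  C (dmfun1 h) -> C f -> C ([ffun v => h (f v)] : dmfun n).
Proof.
move=> Ch Cf.
suff -> : [ffun v => h (f v)] = dmcomp (dmfun1 h) (fun=> f).
  exact: dmclone_comp.
by apply/ffunP => v; rewrite !ffunE tnth_mktuple.
Qed.

Lemma clone_op2 (h : DM4 -> DM4 -> DM4) n (f g : dmfun n) :
  C (dmfun2 h) -> C f -> C g -> C ([ffun v => h (f v) (g v)] : dmfun n).
Proof.
move=> Ch Cf Cg.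
suff -> : [ffun v => h (f v) (g v)] =
          dmcomp (dmfun2 h) (fun i : 'I_2 => if i == ord0 then f else g).
  by apply: dmclone_comp => // i; case: ifP.
by apply/ffunP => v; rewrite !ffunE !tnth_mktuple.
Qed.

Lemma clone_meet n (f g : dmfun n) :
  C f -> C g -> C ([ffun v => (f v `&` g v)%O] : dmfun n).
Proof.
apply: (clone_op2 (h := fun x y => (x `&` y)%O)).
exact: DMA_gen_sub DMA_meet.
Qed.

Lemma clone_join n (f g : dmfun n) :
  C f -> C g -> C ([ffun v => (f v `|` g v)%O] : dmfun n).
Proof.
apply: (clone_op2 (h := fun x y => (x `|` y)%O)).
exact: DMA_gen_sub DMA_join.
Qed.

Lemma clone_neg n (f : dmfun n) :
  C f -> C ([ffun v => dm_neg (f v)] : dmfun n).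
Proof. by apply: (clone_op1 (h := dm_neg)); exact: DMA_gen_sub DMA_neg. Qed.

Lemma clone_true n : 0 < n -> C ([ffun=> dmT] : dmfun n).
Proof.
case: n => // n _.
have := clone_op1 (DMA_gen_sub DMA_true) (dmclone_proj cloneC (@ord0 n)).
by congr C; apply/ffunP => v; rewrite !ffunE.
Qed.

Lemma clone_false n : 0 < n -> C ([ffun=> dmF] : dmfun n).
Proof.
case: n => // n _.
have := clone_op1 (DMA_gen_sub DMA_false) (dmclone_proj cloneC (@ord0 n)).
by congr C; apply/ffunP => v; rewrite !ffunE.
Qed.

Lemma clone_bigmeet n (I : finType) (P : pred I) (F : I -> dmfun n) :
    0 < n -> (forall i, P i -> C (F i)) ->
  exists2 f : dmfun n, C f &
    forall p v, dm_filter p (f v) = [forall (i | P i), dm_filter p (F i v)].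
Proof.
move=> n_gt0 CF.
exists [ffun v => (\big[Order.meet/dmT]_(i | P i) F i v)%O].
  elim: (index_enum I) => [|i s IHs].
    have := clone_true n_gt0.
    by congr C; apply/ffunP => v; rewrite !ffunE big_nil.
  have [Pi|Pi'] := boolP (P i); last first.
    by move: IHs; congr C; apply/ffunP => v; rewrite !ffunE big_cons (negPf Pi').
  have := clone_meet (CF i Pi) IHs.
  by congr C; apply/ffunP => v; rewrite !ffunE big_cons Pi.
move=> p v; rewrite ffunE -big_andE.
by rewrite (big_morph (dm_filter p) (dm_filterI p) (dm_filter1 p)).
Qed.

Lemma clone_bigjoin n (I : finType) (P : pred I) (F : I -> dmfun n) :
    0 < n -> (forall i, P i -> C (F i)) ->
  exists2 f : dmfun n, C f &
    forall p v, dm_filter p (f v) = [exists (i | P i), dm_filter p (F i v)].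
Proof.
move=> n_gt0 CF.
exists [ffun v => (\big[Order.join/dmF]_(i | P i) F i v)%O].
  elim: (index_enum I) => [|i s IHs].
    have := clone_false n_gt0.
    by congr C; apply/ffunP => v; rewrite !ffunE big_nil.
  have [Pi|Pi'] := boolP (P i); last first.
    by move: IHs; congr C; apply/ffunP => v; rewrite !ffunE big_cons (negPf Pi').
  have := clone_join (CF i Pi) IHs.
  by congr C; apply/ffunP => v; rewrite !ffunE big_cons Pi.
move=> p v; rewrite ffunE -big_orE.
by rewrite (big_morph (dm_filter p) (dm_filterU p) (dm_filter0 p)).
Qed.

(** View functions as sets of pairs (input, filter). For each i in g and j outside g some member of
    C contains i but not j; g is the join over i of the meets over j of these members. *)
Lemma clone_filter_interpolation n (g : dmfun n) : 0 < n ->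
    (forall u v p q,
       (forall f : dmfun n, C f -> dm_filter p (f u) -> dm_filter q (f v)) ->
     dm_filter p (g u) -> dm_filter q (g v)) ->
  C g.
Proof.
move=> n_gt0 gP.
pose on (f : dmfun n) (i : n.-tuple DM4 * bool) := dm_filter i.2 (f i.1).
(* The conditions sit under the existential so that a witness can be chosen for all i and j; where
   they fail, g is a dummy. *)
have sep i j : exists f : dmfun n, on g i -> ~~ on g j ->
    [/\ C f, on f i & ~~ on f j].
  have [gi|] := boolP (on g i); last by exists g.
  have [|gj'] := boolP (on g j); first by exists g.
  apply: contrapT => nof; move: gj'; apply/negP; rewrite negbK.
  apply: gP gi => f Cf fi; apply: contrapT => /negP fj; apply: nof.
  by exists f.
pose F i j := projT1 (cid (sep i j)).
have FP i j : on g i -> ~~ on g j -> [/\ C (F i j), on (F i j) i & ~~ on (F i j) j].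
  by rewrite /F; case: cid.
have row i : exists f : dmfun n, on g i -> C f /\
    forall p v, dm_filter p (f v) =
      [forall (j | ~~ on g j), dm_filter p (F i j v)].
  have [gi|] := boolP (on g i); last by exists g.
  have [|f Cf fE] := @clone_bigmeet n _ (fun j => ~~ on g j) (F i) n_gt0.
    by move=> j gj'; have [] := FP i j gi gj'.
  by exists f.
pose G i := projT1 (cid (row i)).
have GP i : on g i -> C (G i) /\ forall p v, dm_filter p (G i v) =
      [forall (j | ~~ on g j), dm_filter p (F i j v)].
  by rewrite /G; case: cid.
have [|f Cf fE] := @clone_bigjoin n _ (on g) G n_gt0.
  by move=> i /GP[].
suff -> : g = f by [].
apply/ffunP => v; apply: dm_filter_inj => p; rewrite fE.
apply/idP/existsP => [gv|[i /andP[gi]]].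
  exists (v, p); rewrite /on /= gv /=.
  have [_ ->] := GP (v, p) gv.
  by apply/forall_inP => j gj'; have [] := FP (v, p) j gv gj'.
have [_ ->] := GP i gi => /forall_inP Gv.
apply: contraT => gv'; have [_ _] := FP i (v, p) gi gv'.
by rewrite /on /= Gv.
Qed.

Lemma clone_info_interpolation n (g : dmfun n) : 0 < n ->
    (forall u v, (forall f : dmfun n, C f -> dm_info (f u) (f v)) ->
       dm_info (g u) (g v)) ->
    (forall u v, (forall f : dmfun n, C f -> dm_info (f u) (dm_conf (f v))) ->
       dm_info (g u) (dm_conf (g v))) ->
    (forall u v, (forall f : dmfun n, C f -> dm_info (dm_conf (f u)) (f v)) ->
       dm_info (dm_conf (g u)) (g v)) ->
  C g.
Proof.
move=> n_gt0 g_info g_infor g_infol.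
apply: clone_filter_interpolation => // u v p q fP.
(* Negation turns an implication between filters into the converse one        *)
(* between the opposite filters, which together make up [dm_info].            *)
have fNP (f : dmfun n) : C f -> dm_filter (~~ q) (f v) -> dm_filter (~~ p) (f u).
  by move=> /clone_neg/fP; rewrite !ffunE !dm_filterN; exact: contraTT.
case: p q fP fNP => [] [] fP fNP.
- have /g_info: forall f : dmfun n, C f -> dm_info (f u) (f v).
    by move=> f Cf; apply/dm_infoP; split; [exact: fP | exact: fNP].
  by case/dm_infoP.
- have /g_infor: forall f : dmfun n, C f -> dm_info (f u) (dm_conf (f v)).
    by move=> f Cf; apply/dm_infoP; rewrite !dm_filter_conf; split;
      [exact: fP | exact: fNP].
  by case/dm_infoP; rewrite !dm_filter_conf.
- have /g_infol: forall f : dmfun n, C f -> dm_info (dm_conf (f u)) (f v).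
    by move=> f Cf; apply/dm_infoP; rewrite !dm_filter_conf; split;
      [exact: fP | exact: fNP].
  by case/dm_infoP; rewrite !dm_filter_conf.
(* Two [false] filters give the first relation again, with u and v exchanged. *)
- have /g_info: forall f : dmfun n, C f -> dm_info (f v) (f u).
    by move=> f Cf; apply/dm_infoP; split; [exact: fNP | exact: fP].
  by case/dm_infoP.
Qed.

(** Substituting the functions h into f gives an m-ary member of C whose values at u and v are [f w]
    and [f w']. *)
Lemma clone_subst m n (f : dmfun n) (R : DM4 -> DM4 -> bool)
    (w w' : n.-tuple DM4) (u v : m.-tuple DM4) :
    (forall h : dmfun m, C h -> R (h u) (h v)) ->
    (forall i, exists h : dmfun m, [/\ C h, h u = tnth w i & h v = tnth w' i]) ->
  C f -> R (f w) (f w').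
Proof.
move=> RC /fin_all_exists[h hP] Cf.
have := RC _ (dmclone_comp cloneC Cf (fun i => let: And3 Ch _ _ := hP i in Ch)).
rewrite !ffunE; congr (R (f _) (f _)); apply: eq_from_tnth => i;
  by rewrite tnth_mktuple; case: (hP i).
Qed.

(** * Relations forced by omitting each function *)

(** Among inputs related coordinatewise, [mnh21] fails only at (b,n) and (n,b), in either order, for
    the third relation of the criterion. A member of C failing there too would let interpolation put
    [mnh21] in C. *)
Lemma mnh21_or_info_confl : ~ C mnh21 ->
  forall f : dmfun 2, C f ->
    dm_info (dm_conf (f [tuple dmB; dmN])) (f [tuple dmN; dmB]).
Proof.
move=> nC f Cf; apply: contrapT => nf; apply: nC.
apply: clone_info_interpolation => // u v uvP;
  move: (uvP _ (dmclone_proj cloneC ord0)) (uvP _ (dmclone_proj cloneC ord_max));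
  move: uvP; have [[a [b ->]] [c [d ->]]] := (tuple2P u, tuple2P v);
  rewrite !ffunE => /(_ f Cf).
- by move=> _; case: a c => [] [] //; case: b d => [] [].
- by move=> _; case: a c => [] [] //; case: b d => [] [].
(* Conflation turns the failure with u and v exchanged into the one assumed for f. *)
- by case: a c => [] [] //; case: b d => [] [] //; rewrite -dm_info_conf dm_confK.
Qed.

Lemma mnh22_or_info_confr : ~ C mnh22 ->
  forall f : dmfun 2, C f ->
    dm_info (f [tuple dmB; dmN]) (dm_conf (f [tuple dmN; dmB])).
Proof.
move=> nC f Cf; apply: contrapT => nf; apply: nC.
apply: clone_info_interpolation => // u v uvP;
  move: (uvP _ (dmclone_proj cloneC ord0)) (uvP _ (dmclone_proj cloneC ord_max));
  move: uvP; have [[a [b ->]] [c [d ->]]] := (tuple2P u, tuple2P v);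
  rewrite !ffunE => /(_ f Cf).
- by move=> _; case: a c => [] [] //; case: b d => [] [].
- by case: a c => [] [] //; case: b d => [] [] //; rewrite -dm_info_conf dm_confK.
- by move=> _; case: a c => [] [] //; case: b d => [] [].
Qed.

Lemma conf_rel_preserved : ~ C mnh21 -> ~ C mnh22 ->
  forall n (f : dmfun n), C f -> dmpreserves dm_conf_rel f.
Proof.
move=> n21 n22 n f Cf u v uv; have n_gt0 := dmclone_arity cloneC Cf.
apply: (clone_subst (R := dm_conf_rel) (u := [tuple dmB; dmN])
                   (v := [tuple dmN; dmB])) Cf.
  move=> h Ch; apply/eqP; apply: dm_conf_infoP.
    exact: mnh22_or_info_confr.
  exact: mnh21_or_info_confl.
move=> i; rewrite -(eqP (uv i)); case: (tnth u i).
- by exists [ffun=> dmT]; rewrite !ffunE; split=> //; exact: clone_true.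
- by exists [ffun=> dmF]; rewrite !ffunE; split=> //; exact: clone_false.
- by exists (dmproj ord_max); rewrite !ffunE; split=> //; exact: dmclone_proj.
- by exists (dmproj ord0); rewrite !ffunE; split=> //; exact: dmclone_proj.
Qed.

(** When functions commute with conflation, it can be moved onto the inputs, which reduces the two
    mixed relations to [dm_info]. *)
Lemma clone_conf_interpolation n (g : dmfun n) : 0 < n ->
    (forall f : dmfun n, C f -> dmpreserves dm_conf_rel f) ->
    dmpreserves dm_conf_rel g ->
    (forall u v, (forall f : dmfun n, C f -> dm_info (f u) (f v)) ->
       dm_info (g u) (g v)) ->
  C g.
Proof.
move=> n_gt0 C_conf g_conf g_info.
have confE (f : dmfun n) v :
    dmpreserves dm_conf_rel f -> dm_conf (f v) = f (map_tuple dm_conf v).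
  by move=> f_conf; apply/eqP/f_conf => i; rewrite /dm_conf_rel tnth_map.
apply: clone_info_interpolation => // u v uvP; rewrite confE //;
  apply: g_info => f Cf;
  by rewrite -confE ?uvP //; exact: C_conf.
Qed.

Lemma mhnp3_conf : dmpreserves dm_conf_rel mhnp3.
Proof.
move=> u v; have [[a [b [c ->]]] [a' [b' [c' ->]]]] := (tuple3P u, tuple3P v).
move=> uv; move: (uv ord0) (uv (inord 1)) (uv ord_max) => {uv}.
rewrite /tnth inordK //= => /eqP<- /eqP<- /eqP<-.
by rewrite !ffunE; case: b; case: a => //; case: c.
Qed.

(** Among inputs ordered coordinatewise, [mhnp3] violates [dm_info] only at this pair and at its
    conflate. *)
Lemma mhnp3_or_info :
    (forall n (f : dmfun n), C f -> dmpreserves dm_conf_rel f) -> ~ C mhnp3 ->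
  forall f : dmfun 3, C f ->
    dm_info (f [tuple dmN; dmN; dmB]) (f [tuple dmT; dmN; dmB]).
Proof.
move=> C_conf nC f Cf; apply: contrapT => nf; apply: nC.
apply: clone_conf_interpolation => //; [exact: C_conf | exact: mhnp3_conf |].
move=> u v uvP; move: (uvP _ Cf).
move: (uvP _ (dmclone_proj cloneC ord0)) (uvP _ (dmclone_proj cloneC (inord 1)))
  (uvP _ (dmclone_proj cloneC ord_max)) => {uvP}.
have [[a [b [c ->]]] [a' [b' [c' ->]]]] := (tuple3P u, tuple3P v).
rewrite !ffunE /tnth inordK //=.
(* The second violating pair is mapped to the first one by conflation.        *)
have f_conf : dm_info (f [tuple dmT; dmB; dmN]) (f [tuple dmB; dmB; dmN]) ->
              dm_info (f [tuple dmN; dmN; dmB]) (f [tuple dmT; dmN; dmB]).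
  rewrite -dm_info_conf.
  have conf_f w w' : (forall i, dm_conf_rel (tnth w i) (tnth w' i)) ->
    dm_conf (f w) = f w' by move=> ww'; apply/eqP/(C_conf _ f).
  rewrite (conf_f _ [tuple dmN; dmN; dmB]) ?(conf_f _ [tuple dmT; dmN; dmB]) //;
    by case=> [[|[|[|]]]].
by case: b b' => [] [] //; case: a a' => [] [] //;
  case: c c' => [] [] // _ _ _ /f_conf.
Qed.

Lemma info_preserved :
    (forall n (f : dmfun n), C f -> dmpreserves dm_conf_rel f) -> ~ C mhnp3 ->
  forall n (f : dmfun n), C f -> dmpreserves dm_info f.
Proof.
move=> C_conf nC n f Cf u v uv.
pose x : dmfun 3 := dmproj ord0.
pose y : dmfun 3 := dmproj (inord 1).
pose z : dmfun 3 := dmproj ord_max.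
have [Cx Cy Cz] : [/\ C x, C y & C z] by split; exact: dmclone_proj.
(* At the inputs (n,n,b) and (t,n,b), [Cxz] yields the pair of values (f,b), its negation (t,b), and
   [Cnb] yields (n,b). *)
have Cxz := clone_meet Cx Cz.
have Ctrue := clone_true (isT : 0 < 3).
have Cfalse := clone_false (isT : 0 < 3).
have Cnb := clone_meet Cx (clone_neg Cxz).
apply: (clone_subst (R := dm_info) (u := [tuple dmN; dmN; dmB])
                   (v := [tuple dmT; dmN; dmB])) Cf.
  by move=> h Ch; exact: mhnp3_or_info.
move=> i; move: (uv i); case: (tnth u i) (tnth v i) => [] [] // _.
- by eexists; split; first exact: Ctrue; rewrite !ffunE.
- by eexists; split; first exact: (clone_neg Cxz); rewrite !ffunE.
- by eexists; split; first exact: Cfalse; rewrite !ffunE.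
- by eexists; split; first exact: Cxz; rewrite !ffunE.
- by eexists; split; first exact: Cx; rewrite !ffunE.
- by eexists; split; first exact: (clone_neg Cx); rewrite !ffunE.
- by eexists; split; first exact: Cy; rewrite !ffunE /tnth inordK.
- by eexists; split; first exact: Cnb; rewrite !ffunE.
- by eexists; split; first exact: Cz; rewrite !ffunE.
Qed.

End CloneOverDMA.

(** * Generated clones and invariant relations *)

Lemma dmgenerated_sub (G : dmset) : dmsubset G (dmgenerated G).
Proof. by move=> n f Gf D _; apply. Qed.

Lemma dmgenerated_clone (G : dmset) :
  (forall n (f : dmfun n), G n f -> 0 < n) -> dmclone (dmgenerated G).
Proof.
move=> G_gt0; split=> [n f | n i | n m f g genf geng].
(* All functions of positive arity form a clone containing G. *)
- move/(_ (fun k _ => 0 < k)); apply=> //.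
  by split=> // [[[]|] // | k m f' g k_gt0 /(_ (Ordinal k_gt0))].
- by move=> D cloneD _; exact: dmclone_proj.
- move=> D cloneD GD; apply: dmclone_comp => //; first exact: genf.
  by move=> i; exact: geng.
Qed.

Lemma DMA_clone : dmclone DMA.
Proof. by apply: dmgenerated_clone => n f []. Qed.

Definition dmpol (R : DM4 -> DM4 -> bool) : dmset :=
  fun n f => 0 < n /\ dmpreserves R f.

Lemma dmpol_clone R : dmclone (dmpol R).
Proof.
split=> [n f [] // | n i | n m f g [n_gt0 fR] gR].
  by split=> [|u v]; [case: n i => // -[] | rewrite !ffunE].
split=> [|u v uv]; first by have [] := gR (Ordinal n_gt0).
rewrite !ffunE; apply: fR => i; rewrite !tnth_mktuple.
by have [_] := gR i; apply.
Qed.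

(** Join needs no condition of its own, by De Morgan's law. *)
Lemma dmpol_DMA_gen (R : DM4 -> DM4 -> bool) :
    R dmT dmT -> R dmF dmF ->
    (forall x y, R x y -> R (dm_neg x) (dm_neg y)) ->
    (forall x y x' y', R x y -> R x' y' -> R (x `&` x')%O (y `&` y')%O) ->
  dmsubset DMA_gen (dmpol R).
Proof.
move=> Rt Rf RN RI n f; case=> {n f}; split=> // u v uv; rewrite !ffunE //.
- by apply: RI; exact: uv.
- have joinE (x y : DM4) : (x `|` y = dm_neg (dm_neg x `&` dm_neg y))%O.
    by case: x y => [] [].
  by rewrite !joinE; apply/RN/RI; apply: RN; exact: uv.
- by apply: RN; exact: uv.
Qed.

Lemma DMA_adjoin_not_subset R k l (g : dmfun k) (h : dmfun l) :
    dmsubset DMA_gen (dmpol R) -> dmpol R g -> ~ dmpol R h ->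
  ~ dmsubset (DMA_adjoin h) (DMA_adjoin g).
Proof.
move=> RDMA Rg Rh sub; apply: Rh.
have : DMA_adjoin h h by apply: dmgenerated_sub; right.
move/sub; apply; first exact: dmpol_clone.
move=> n f [DMAf | [] //]; exact: DMAf (dmpol_clone R) RDMA.
Qed.
Theorem mainTheorem9 :
  (forall C : dmset, dmclone C -> dmproper DMA C ->
     C 2 mnh21 \/ C 2 mnh22 \/ C 3 mhnp3) /\
  (dmincomparable (DMA_adjoin mhnp3) (DMA_adjoin mnh21) /\
   dmincomparable (DMA_adjoin mhnp3) (DMA_adjoin mnh22) /\
   dmincomparable (DMA_adjoin mnh21) (DMA_adjoin mnh22)).
Proof.
split=> [C cloneC [DMAC nCDMA]|].
  apply: contrapT => /not_orP[n21 /not_orP[n22 n3]]; apply: nCDMA => n f Cf.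
  have C_conf := conf_rel_preserved cloneC DMAC n21 n22.
  have C_info := info_preserved cloneC DMAC C_conf n3.
  apply: (clone_conf_interpolation DMA_clone) => //.
  - exact: dmclone_arity Cf.
  - by move=> g /DMAC/C_conf.
  - exact: C_conf.
  (* Evaluating the hypothesis at the projections gives the order of u and v coordinatewise. *)
  - by move=> u v uv; apply: C_info => // i;
    have := uv _ (dmclone_proj DMA_clone i); rewrite !ffunE.
pose Rr x y := dm_info x (dm_conf y).
pose Rl x y := dm_info (dm_conf x) y.
have info_DMA : dmsubset DMA_gen (dmpol dm_info).
  by apply: dmpol_DMA_gen => // [[] [] | [] [] [] []].
have conf_DMA : dmsubset DMA_gen (dmpol dm_conf_rel).
  by apply: dmpol_DMA_gen => // [[] [] | [] [] [] []].
have Rr_DMA : dmsubset DMA_gen (dmpol Rr).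
  by apply: dmpol_DMA_gen => // [[] [] | [] [] [] []].
have Rl_DMA : dmsubset DMA_gen (dmpol Rl).
  by apply: dmpol_DMA_gen => // [[] [] | [] [] [] []].
have pol2 (R : DM4 -> DM4 -> bool) (g : dmfun 2) :
    (forall a b c d, R a c -> R b d -> R (g [tuple a; b]) (g [tuple c; d])) ->
  dmpol R g.
  move=> gP; split=> // u v; have [[a [b ->]] [c [d ->]]] := (tuple2P u, tuple2P v).
  by move=> uv; apply: gP; [exact: (uv ord0) | exact: (uv ord_max)].
have info21 : dmpol dm_info mnh21.
  by apply: pol2 => a b c d; rewrite !ffunE;
    case: a c => [] [] //; case: b d => [] [].
have info22 : dmpol dm_info mnh22.
  by apply: pol2 => a b c d; rewrite !ffunE;
    case: a c => [] [] //; case: b d => [] [].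
have Rr21 : dmpol Rr mnh21.
  by apply: pol2 => a b c d; rewrite !ffunE;
    case: a c => [] [] //; case: b d => [] [].
have Rl22 : dmpol Rl mnh22.
  by apply: pol2 => a b c d; rewrite !ffunE;
    case: a c => [] [] //; case: b d => [] [].
have conf3 : dmpol dm_conf_rel mhnp3 by split=> //; exact: mhnp3_conf.
have ninfo3 : ~ dmpol dm_info mhnp3.
  case=> _ /(_ [tuple dmN; dmN; dmB] [tuple dmT; dmN; dmB]); rewrite !ffunE.
  by move=> H; have: false by apply: H; case=> [[|[|[|]]]].
(* The inputs (b,n) and (n,b) serve all four refutations below. *)
have nBN (R : DM4 -> DM4 -> bool) (g : dmfun 2) : R dmB dmN -> R dmN dmB ->
    ~~ R (g [tuple dmB; dmN]) (g [tuple dmN; dmB]) -> ~ dmpol R g.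
  move=> RBN RNB /negP ng [_ gP]; apply/ng/gP.
  by case=> [[|[|]]].
have nconf21 : ~ dmpol dm_conf_rel mnh21 by apply: nBN; rewrite ?ffunE.
have nconf22 : ~ dmpol dm_conf_rel mnh22 by apply: nBN; rewrite ?ffunE.
have nRl21 : ~ dmpol Rl mnh21 by apply: nBN; rewrite ?ffunE.
have nRr22 : ~ dmpol Rr mnh22 by apply: nBN; rewrite ?ffunE.
split; last split; split.
- exact: DMA_adjoin_not_subset info_DMA info21 ninfo3.
- exact: DMA_adjoin_not_subset conf_DMA conf3 nconf21.
- exact: DMA_adjoin_not_subset info_DMA info22 ninfo3.
- exact: DMA_adjoin_not_subset conf_DMA conf3 nconf22.
- exact: DMA_adjoin_not_subset Rl_DMA Rl22 nRl21.
- exact: DMA_adjoin_not_subset Rr_DMA Rr21 nRr22.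
Qed.
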